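(* Let $G=(V,E)$ be a finite connected simple graph with chromatic number $\chi$, and let $V_1,\dots,V_\chi$ be the coloring classes of a proper $\chi$-coloring $c$ that is equitable with respect to $D^{-1}A$. Let $I\subseteq\{1,\dots,\chi\}$ with $|I|\geq1$, let $W=\bigcup_{i\in I}V_i$, let $G(W)$ be the subgraph of $G$ induced by $W$, and let $f:V\to\mathbb{R}$ be a function, not identically zero, with $\mathrm{supp}(f)\subseteq W$. Then \[\mathrm{RQ}_G(f)=\frac{|I|-1}{\chi-1}\,\mathrm{RQ}_{G(W)}\bigl(f|_{W}\bigr)+\frac{\chi-|I|}{\chi-1},\] where, when $|I|=1$, the first summand (whose coefficient is $0$) is interpreted as $0$.
   Context: For a graph $H$ and a function $g:V(H)\to\mathbb{R}$ not identically zero, the Rayleigh quotient is $\mathrm{RQ}_H(g)=\frac{\sum_{\{v,w\}\in E(H)}(g(v)-g(w))^2}{\sum_{v\in V(H)}\deg_H v\, g(v)^2}$, with degrees taken in $H$. For $v\in V$ and $U\subseteq V$, $e(v,U)$ is the number of edges of $G$ joining $v$ to a vertex of $U$. A proper $\chi$-coloring with classes $V_1,\dots,V_\chi$ is equitable with respect to $D^{-1}A$ if for all $i$ and all $v\in V$: $e(v,V_i)=\deg v/(\chi-1)$ if $v\notin V_i$, and $e(v,V_i)=0$ if $v\in V_i$. *)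

(* Defs.v *)
From HB Require Import structures.
From mathcomp Require Import all_boot all_order all_algebra.

Set Implicit Arguments.
Unset Strict Implicit.
Unset Printing Implicit Defensive.

Import Order.TTheory GRing.Theory Num.Theory.
Local Open Scope ring_scope.

Record sgraph := SGraph {
  vertex :> finType;
  adj : rel vertex;
  adj_sym : symmetric adj;
  adj_irrefl : irreflexive adj
}.

Definition connected_graph (G : sgraph) : Prop :=
  (0 < #|G|)%N /\ (forall v w : G, connect (@adj G) v w).

Definition edge_count (G : sgraph) (v : G) (U : {set G}) : nat :=
  #|[set w in U | adj v w]|.

Definition deg (G : sgraph) (v : G) : nat := #|[set w : G | adj v w]|.

Section Induced.
Variables (G : sgraph) (W : {set G}).

Definition induced_adj : rel {v : G | v \in W} :=
  fun v w => adj (val v) (val w).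

Lemma induced_adj_sym : symmetric induced_adj.
Proof. by move=> v w; exact: adj_sym. Qed.

Lemma induced_adj_irrefl : irreflexive induced_adj.
Proof. by move=> v; exact: adj_irrefl. Qed.

Definition induced : sgraph := SGraph induced_adj_sym induced_adj_irrefl.
End Induced.

(* The numerator is indexed by unordered edges: each {v, w} is represented by
   the ordered pair whose first component comes first in the enumeration of
   the vertices.  When the denominator vanishes (e.g. on an edgeless graph) the
   quotient is 0, by the convention x / 0 = 0. *)
Definition RQ (R : realFieldType) (H : sgraph) (g : H -> R) : R :=
  (\sum_(p : H * H | adj p.1 p.2 && (enum_rank p.1 < enum_rank p.2)%N)
      (g p.1 - g p.2) ^+ 2)
  / (\sum_(v : H) (deg v)%:R * g v ^+ 2).

Definition proper_coloring (G : sgraph) (k : nat) (c : G -> 'I_k) : bool :=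
  [forall v, forall w, adj v w ==> (c v != c w)].

Definition colorable (G : sgraph) (k : nat) : bool :=
  [exists c : {ffun G -> 'I_k}, proper_coloring c].

Lemma colorable_exists (G : sgraph) : exists k, colorable G k.
Proof.
exists #|G|; apply/existsP; exists [ffun v => enum_rank v].
apply/forallP=> v; apply/forallP=> w; apply/implyP=> vw; rewrite !ffunE.
by apply: contraTneq vw => /enum_rank_inj ->; rewrite adj_irrefl.
Qed.

Definition chromatic_number (G : sgraph) : nat := ex_minn (colorable_exists G).

Definition color_class (G : sgraph) (k : nat) (c : G -> 'I_k) (i : 'I_k) :
    {set G} :=
  [set v | c v == i].

(* Equitability with respect to the normalized adjacency matrix D^-1 A. *)
Definition equitable (R : realFieldType) (G : sgraph) (k : nat)
    (c : G -> 'I_k) : Prop :=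
  forall (i : 'I_k) (v : G),
    (edge_count v (color_class c i))%:R =
      (if v \in color_class c i then 0 else (deg v)%:R / (k%:R - 1)) :> R.

Definition color_union (G : sgraph) (k : nat) (c : G -> 'I_k)
    (I : {set 'I_k}) : {set G} :=
  \bigcup_(i in I) color_class c i.

(* Main.v *)
Require Import Defs.
From HB Require Import structures.
From mathcomp Require Import all_boot all_order all_algebra.
From mathcomp Require Import ring.

Set Implicit Arguments.
Unset Strict Implicit.
Unset Printing Implicit Defensive.

Import Order.TTheory GRing.Theory Num.Theory.
Local Open Scope ring_scope.

(* Expanding the squares, the numerator of RQ_H(g) is D_H(g) - S_H(g), where
   D_H(g) is the denominator and S_H(g) is the sum of g(v) g(w) over ordered
   adjacent pairs.  Since f vanishes off W, S_G(f) = S_{G(W)}(f|_W).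
   Equitability gives deg_{G(W)} v = (|I|-1)/(chi-1) deg_G v for v in W, hence
   D_{G(W)}(f|_W) = (|I|-1)/(chi-1) D_G(f), and the formula follows. *)

Definition energy (R : realFieldType) (H : sgraph) (g : H -> R) : R :=
  \sum_(v : H) (deg v)%:R * g v ^+ 2.

Definition adj_form (R : realFieldType) (H : sgraph) (g : H -> R) : R :=
  \sum_(v : H) \sum_(w : H | adj v w) g v * g w.

Lemma sum_adj_energy (R : realFieldType) (H : sgraph) (g : H -> R) :
  \sum_(v : H) \sum_(w : H | adj v w) g v ^+ 2 = energy g.
Proof.
apply: eq_bigr => v _; rewrite sumr_const /deg mulr_natl.
by congr (_ *+ _); apply: eq_card => w; rewrite inE.
Qed.

(** The sum of squared differences over ordered adjacent pairs is evaluated twice: each edge occurs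
    in both orientations, giving [N + N], and expanding the squares gives twice the right-hand side.
    Cancelling 2 concludes. *)
Lemma dirichlet_energy (R : realFieldType) (H : sgraph) (g : H -> R) :
  \sum_(p : H * H | adj p.1 p.2 && (enum_rank p.1 < enum_rank p.2)%N)
     (g p.1 - g p.2) ^+ 2 = energy g - adj_form g.
Proof.
set N := LHS.
have swapK : involutive (fun p : H * H => (p.2, p.1)) by case.
have twoN : \sum_(p : H * H | adj p.1 p.2) (g p.1 - g p.2) ^+ 2 = N + N.
  (* Swapping components carries the pairs not in increasing rank order onto those that are; equal
     ranks would force a loop, excluded by irreflexivity. *)
  rewrite (bigID (fun p : H * H => enum_rank p.1 < enum_rank p.2)%N) /=.
  congr (_ + _); rewrite (reindex_inj (inv_inj swapK)) /=.
  apply: eq_big => [[v w] | [v w] _] /=; last by rewrite -opprB sqrrN.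
  rewrite adj_sym -leqNgt leq_eqVlt; have [->|nvw] := eqVneq v w.
    by rewrite adj_irrefl.
  by case: eqP => // /val_inj/enum_rank_inj vw; rewrite vw eqxx in nvw.
have sumE : \sum_(p : H * H | adj p.1 p.2) (g p.1 - g p.2) ^+ 2
    = 2 * (energy g - adj_form g).
  rewrite -(pair_big_dep xpredT (fun v w : H => adj v w)
              (fun v w => (g v - g w) ^+ 2)) /=.
  have sym : \sum_(v : H) \sum_(w : H | adj v w) g w ^+ 2 = energy g.
    rewrite (exchange_big_dep xpredT) //= -sum_adj_energy.
    by apply: eq_bigr => v _; apply: eq_bigl => w; rewrite adj_sym.
  (* One copy of the energy is written with [g v ^+ 2], the other with [g w ^+ 2], so that both
     sides agree term by term. *)
  rewrite mulrBr mulr2n !mulrDl !mul1r -{1}sum_adj_energy -sym /adj_form.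
  rewrite -!big_split -sumrB /=; apply: eq_bigr => v _.
  rewrite -!big_split -sumrB /=; apply: eq_bigr => w _.
  by ring.
have two0 : 2 != 0 :> R by rewrite pnatr_eq0.
by apply: (mulfI two0); rewrite -sumE twoN mulr2n mulrDl mul1r.
Qed.

Lemma RQE (R : realFieldType) (H : sgraph) (g : H -> R) :
  RQ g = (energy g - adj_form g) / energy g.
Proof. by rewrite /RQ dirichlet_energy. Qed.

Lemma in_color_union (G : sgraph) (k : nat) (c : G -> 'I_k) (I : {set 'I_k})
  (v : G) : (v \in color_union c I) = (c v \in I).
Proof.
apply/bigcupP/idP => [[i iI]|cvI]; first by rewrite inE => /eqP ->.
by exists (c v) => //; rewrite inE.
Qed.

Lemma proper_coloringP (G : sgraph) (k : nat) (c : G -> 'I_k) :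
  reflect (forall v w, adj v w -> c v != c w) (proper_coloring c).
Proof.
apply: (iffP forallP) => [h v w|h v].
  by move/forallP: (h v) => /(_ w)/implyP.
by apply/forallP => w; apply/implyP; exact: h.
Qed.

Lemma edge_count_color_union (G : sgraph) (k : nat) (c : G -> 'I_k)
  (I : {set 'I_k}) (v : G) :
  edge_count v (color_union c I)
    = (\sum_(i in I) edge_count v (color_class c i))%N.
Proof.
rewrite /edge_count -sum1_card (partition_big c (mem I)) /=; last first.
  by move=> w; rewrite inE in_color_union => /andP[].
apply: eq_bigr => i iI; rewrite -sum1_card; apply: eq_bigl => w.
rewrite !inE in_color_union; have [->|_] := eqVneq (c w) i.
  by rewrite iI andbT.
by rewrite andbF.
Qed.

Lemma deg_induced (G : sgraph) (W : {set G}) (v : induced W) :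
  deg v = edge_count (val v) W.
Proof.
rewrite /deg /edge_count -!sum1_card.
rewrite (eq_bigl (fun w => (w \in W) && adj (val v) w)); last first.
  by move=> w; rewrite inE.
by rewrite big_sub_cond; apply: eq_bigl => w; rewrite inE.
Qed.

(** Inside the union, [v] has no neighbour in its own class and [deg v / (k - 1)] neighbours, with
    the degree taken in [G], in each of the other [#|I| - 1] classes. *)
Lemma equitable_deg_induced (R : realFieldType) (G : sgraph) (k : nat)
  (c : G -> 'I_k) (I : {set 'I_k}) (v : induced (color_union c I)) :
  equitable R c ->
  (deg v)%:R = (#|I|%:R - 1) / (k%:R - 1) * (deg (val v))%:R :> R.
Proof.
move=> heq; have cvI : c (val v) \in I by rewrite -in_color_union; exact: valP.
rewrite deg_induced edge_count_color_union natr_sum.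
under eq_bigr => i _ do rewrite heq.
rewrite (bigD1 (c (val v))) //= inE eqxx add0r.
under eq_bigr => i /andP[_ ni] do rewrite inE eq_sym (negPf ni).
rewrite (eq_bigl [in I :\ c (val v)]); last by move=> i; rewrite !inE andbC.
rewrite sumr_const (cardsD1 (c (val v)) I) cvI natrD -[LHS]mulr_natr /=.
by ring.
Qed.

Lemma equitable_energy_induced (R : realFieldType) (G : sgraph) (k : nat)
  (c : G -> 'I_k) (I : {set 'I_k}) (f : G -> R) :
  equitable R c -> (forall v, f v != 0 -> v \in color_union c I) ->
  energy (fun v : induced (color_union c I) => f (val v))
    = (#|I|%:R - 1) / (k%:R - 1) * energy f.
Proof.
move=> heq hsupp; rewrite /energy mulr_sumr.
rewrite (bigID (mem (color_union c I))) /= [X in _ + X]big1 ?addr0.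
  rewrite [RHS]big_sub; apply: eq_bigr => v _.
  by rewrite equitable_deg_induced // [RHS]mulrA.
move=> v vW; have [->|/hsupp] := eqVneq (f v) 0; last by rewrite (negPf vW).
by rewrite expr0n !mulr0.
Qed.

(** A product [f v * f w] with an endpoint outside [W] vanishes, and adjacency inside [W] is
    inherited from [G]. *)
Lemma adj_form_induced (R : realFieldType) (G : sgraph) (W : {set G})
  (f : G -> R) :
  (forall v, f v != 0 -> v \in W) ->
  adj_form (fun v : induced W => f (val v)) = adj_form f.
Proof.
move=> hsupp; have f0 v : v \notin W -> f v = 0.
  by move=> vW; apply: contraNeq vW; exact: hsupp.
rewrite /adj_form [RHS](bigID (mem W)) /= [X in _ = _ + X]big1 ?addr0; last first.
  by move=> v /f0 ->; rewrite big1 // => w _; rewrite mul0r.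
rewrite [RHS]big_sub; apply: eq_bigr => v _.
rewrite [RHS](bigID (mem W)) /= [X in _ = _ + X]big1 ?addr0; last first.
  by move=> w /andP[_ /f0 ->]; rewrite mulr0.
by under [RHS]eq_bigl do rewrite andbC; rewrite [RHS]big_sub_cond.
Qed.

Lemma chromatic_number_le1 (G : sgraph) :
  (forall v w : G, ~~ adj v w) -> (chromatic_number G <= 1)%N.
Proof.
move=> h; rewrite /chromatic_number; case: ex_minnP => m _; apply.
apply/existsP; exists [ffun => ord0]; apply/proper_coloringP => v w.
by rewrite (negPf (h v w)).
Qed.

(** An isolated vertex of a connected graph is its only vertex, so one color would suffice. *)
Lemma connected_deg_gt0 (G : sgraph) (v : G) :
  connected_graph G -> (1 < chromatic_number G)%N -> (0 < deg v)%N.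
Proof.
move=> [_ hG] chi_gt1; rewrite lt0n; apply/negP => /eqP/cards0_eq degv0.
have nadj w : adj v w = false.
  by have := in_set0 w; rewrite -degv0 inE.
have all_v w : w = v.
  (* A nonempty path from [v] would begin with an edge at [v]. *)
  case/connectP: (hG v w) => -[|x p] //=; by rewrite nadj.
move: chi_gt1; rewrite ltnNge chromatic_number_le1 // => x y.
by rewrite (all_v x) (all_v y) adj_irrefl.
Qed.

Lemma energy_gt0 (R : realFieldType) (G : sgraph) (f : G -> R) :
  (forall v : G, (0 < deg v)%N) -> (exists v, f v != 0) -> 0 < energy f.
Proof.
move=> deg_gt0 [v fv]; rewrite /energy (bigD1 v) //= ltr_pwDl //.
  by rewrite mulr_gt0 ?ltr0n // exprn_even_gt0.
by apply: sumr_ge0 => w _; rewrite mulr_ge0 ?ler0n ?sqr_ge0.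
Qed.

(** The support lies in a single color class, which is independent, so every edge has an endpoint
    where [f] is 0. *)
Lemma adj_form_color_class (R : realFieldType) (G : sgraph) (k : nat)
  (c : G -> 'I_k) (I : {set 'I_k}) (f : G -> R) :
  proper_coloring c -> #|I| = 1%N ->
  (forall v, f v != 0 -> v \in color_union c I) -> adj_form f = 0.
Proof.
move=> /proper_coloringP hc /eqP/cards1P[i ->] hsupp.
apply: big1 => v _; apply: big1 => w /hc cvw; apply/eqP; rewrite mulf_eq0.
apply: contraNT cvw; rewrite negb_or => /andP[/hsupp + /hsupp].
by rewrite !in_color_union !inE => /eqP -> /eqP ->.
Qed.

Theorem theorem3p13 (R : realFieldType) (G : sgraph)
    (c : G -> 'I_(chromatic_number G))
    (I : {set 'I_(chromatic_number G)}) (f : G -> R)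
    (hG : connected_graph G)
    (hc : proper_coloring c)
    (heq : equitable R c)
    (hI : (1 <= #|I|)%N)
    (hf0 : exists v : G, f v != 0)
    (hsupp : forall v : G, f v != 0 -> v \in color_union c I) :
  let chi : R := (chromatic_number G)%:R in
  let W := color_union c I in
  RQ f = (#|I|%:R - 1) / (chi - 1) * RQ (fun v : induced W => f (val v))
         + (chi - #|I|%:R) / (chi - 1).
Proof.
move=> chi W; rewrite !RQE equitable_energy_induced // adj_form_induced //.
have := max_card I; rewrite card_ord => leIchi.
have [chi_gt1|chi_le1] := ltnP 1 (chromatic_number G); last first.
  have chi1 : chromatic_number G = 1%N.
    by apply/eqP; rewrite eqn_leq chi_le1 (leq_trans hI).
  have /proper_coloringP cne := hc.
  (* Both sides are 0: the inverse of chi - 1 = 0 is 0, and G is edgeless. *)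
  have deg0 (v : G) : deg v = 0%N.
    apply/eqP; rewrite cards_eq0; apply/eqP/setP => w; rewrite !inE.
    apply/negP => vw; case/eqP: (cne _ _ vw).
    have cast x : (c x : nat) = 0%N by case: (c x) => [[|m]] //=; rewrite chi1.
    by apply: val_inj; rewrite /= !cast.
  have -> : energy f = 0 by apply: big1 => v _; rewrite deg0 mul0r.
  have -> : chi = 1 by rewrite /chi chi1.
  by rewrite subrr invr0 !mulr0 !mul0r addr0.
have D0 : energy f != 0.
  by rewrite gt_eqF // energy_gt0 // => v; exact: connected_deg_gt0.
have chi0 : chi - 1 != 0 by rewrite subr_eq0 /chi pnatr_eq1 gtn_eqF.
(* For a single class the first summand has coefficient 0, and both sides equal 1. *)
have [I1|I_neq1] := eqVneq #|I| 1%N.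
  rewrite (adj_form_color_class hc I1 hsupp) I1 subrr !mul0r add0r subr0.
  by rewrite !divff.
have I0 : #|I|%:R - 1 != 0 :> R by rewrite subr_eq0 pnatr_eq1.
(* With [a = (#|I| - 1) / (chi - 1)], [D = energy f] and [S = adj_form f], this is [(D - S) / D = a
   * ((a * D - S) / (a * D)) + (1 - a)]; the three facts above make the denominators nonzero. *)
by field; apply/and3P.
Qed.
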